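(* Let $\mathcal A$ be a commutative C*-algebra with unit $e$ and let $\mathcal M$ be a Hilbert $\mathcal A$-module such that there exist $x_0\in\mathcal M$ and $f_0\in\mathcal M'$ with $f_0(x_0)=e$. Then each $\mathcal A$-linear local derivation $\delta$ on $\mathrm{End}_{\mathcal A}(\mathcal M)$ is a derivation.
   Context: C*-algebras are complex. A Hilbert $\mathcal A$-module is a left $\mathcal A$-module $\mathcal M$ with an $\mathcal A$-valued inner product $\langle\cdot,\cdot\rangle:\mathcal M\times\mathcal M\to\mathcal A$ satisfying, for $\lambda\in\mathbb C$, $a\in\mathcal A$, $x,y,z\in\mathcal M$: $\langle x,x\rangle\ge 0$, and $\langle x,x\rangle=0$ implies $x=0$; $\langle\lambda x+y,z\rangle=\lambda\langle x,z\rangle+\langle y,z\rangle$; $\langle ax,y\rangle=a\langle x,y\rangle$; $\langle x,y\rangle=\langle y,x\rangle^*$; and such that $\mathcal M$ is complete for the norm $\|x\|=\|\langle x,x\rangle\|^{1/2}$. A linear map $T$ from $\mathcal M$ to $\mathcal M$ or to $\mathcal A$ is $\mathcal A$-linear if $T(ax)=aT(x)$ for all $a\in\mathcal A$, $x\in\mathcal M$. $\mathcal M'$ is the set of all bounded $\mathcal A$-linear maps $\mathcal M\to\mathcal A$, and $\mathrm{End}_{\mathcal A}(\mathcal M)$ is the Banach algebra (operator norm, composition) of all bounded $\mathcal A$-linear maps $\mathcal M\to\mathcal M$. Since $\mathcal A$ is commutative, $\mathrm{End}_{\mathcal A}(\mathcal M)$ is a left $\mathcal A$-module via $(aA)x=a(Ax)$;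 a linear map $\delta$ on $\mathrm{End}_{\mathcal A}(\mathcal M)$ is $\mathcal A$-linear if $\delta(aA)=a\delta(A)$ for all $a\in\mathcal A$, $A\in\mathrm{End}_{\mathcal A}(\mathcal M)$. A derivation on an algebra $\mathcal B$ is a ($\mathbb C$-)linear map $d:\mathcal B\to\mathcal B$ with $d(xy)=d(x)y+xd(y)$ for all $x,y\in\mathcal B$. A local derivation on $\mathcal B$ is a linear map $\delta:\mathcal B\to\mathcal B$ such that for every $a\in\mathcal B$ there is a derivation $d_a:\mathcal B\to\mathcal B$, depending on $a$, with $\delta(a)=d_a(a)$. *)

(* Defs.v *)
From HB Require Import structures.
From mathcomp Require Import all_boot all_order all_algebra.
From mathcomp Require Import complex.
From mathcomp Require Import all_classical all_reals all_analysis.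

Set Implicit Arguments.
Unset Strict Implicit.
Unset Printing Implicit Defensive.

Import Order.TTheory GRing.Theory Num.Theory.
Import numFieldNormedType.Exports.
Local Open Scope classical_set_scope.
Local Open Scope complex_scope.
Local Open Scope ring_scope.

(* The library's rings with a scaling have 1 != 0. The zero algebra has to be
   allowed here: it is a unital C*-algebra, and the operators on the zero module
   form the zero algebra. So the product is a field of the mixin and the ring
   structure (pzRingType) is derived from it below. *)
HB.mixin Record CompleteNormedModule_isCStar (R : realType) A
    of CompleteNormedModule R[i] A := {
  cstar_one : A;
  cstar_mul : A -> A -> A;
  cstar_mulA : associative cstar_mul;
  cstar_mul1 : left_id cstar_one cstar_mul;
  cstar_mulr1 : right_id cstar_one cstar_mul;
  cstar_mulDl : left_distributive cstar_mul +%R;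
  cstar_mulDr : right_distributive cstar_mul +%R;
  cstar_scalerAl : forall (k : R[i]) (x y : A),
    k *: cstar_mul x y = cstar_mul (k *: x) y;
  cstar_scalerAr : forall (k : R[i]) (x y : A),
    k *: cstar_mul x y = cstar_mul x (k *: y);
  star : A -> A;
  starK : involutive star;
  starP : forall (k : R[i]) (x y : A),
    star (k *: x + y) = k^* *: star x + star y;
  starM : forall x y : A, star (cstar_mul x y) = cstar_mul (star y) (star x);
  cstar_normM : forall x y : A, `|cstar_mul x y| <= `|x| * `|y|;
  cstar_norm : forall x : A, `|cstar_mul (star x) x| = `|x| ^+ 2
}.

#[short(type="cstarAlgType")]
HB.structure Definition CStarAlgebra (R : realType) :=
  {A of CompleteNormedModule R[i] A & CompleteNormedModule_isCStar R A}.

HB.mixin Record CStar_hasCommutativeMul (R : realType) A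
    of CStarAlgebra R A := {
  cstar_mulC : commutative (@cstar_mul R A)
}.

#[short(type="comCStarAlgType")]
HB.structure Definition ComCStarAlgebra (R : realType) :=
  {A of CStarAlgebra R A & CStar_hasCommutativeMul R A}.

HB.instance Definition _ (R : realType) (A : cstarAlgType R) :=
  GRing.Zmodule_isPzRing.Build (CStarAlgebra.sort A)
    (@cstar_mulA R A) (@cstar_mul1 R A) (@cstar_mulr1 R A)
    (@cstar_mulDl R A) (@cstar_mulDr R A).

HB.instance Definition _ (R : realType) (A : comCStarAlgType R) :=
  GRing.PzRing.copy (ComCStarAlgebra.sort A)
    (CStarAlgebra.sort (A : cstarAlgType R)).

HB.instance Definition _ (R : realType) (A : comCStarAlgType R) :=
  GRing.PzRing_hasCommutativeMul.Build (ComCStarAlgebra.sort A)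
    (@cstar_mulC R A).

Section positivity.
Context {R : realType} {A : cstarAlgType R}.

Definition invertible (a : A) : Prop := exists b : A, a * b = 1 /\ b * a = 1.

Definition spectrum (a : A) : set R[i] := [set k | ~ invertible (a - k *: (1 : A))].

(* On R[i], 0 <= k means that k is real and nonnegative. *)
Definition cstar_pos (a : A) : Prop :=
  star a = a /\ spectrum a `<=` [set k | 0 <= k].

End positivity.

(* The norm of a normedModType R[i] takes its values in R[i], and sqrtC is the
   nonnegative square root on nonnegative elements. The fields act1, actZl and
   actZr are redundant: the inner product axioms imply them. *)
HB.mixin Record NormedModule_isHilbertModule (R : realType)
    (A : cstarAlgType R) M of CompleteNormedModule R[i] M := {
  act : A -> M -> M;
  act1 : forall x : M, act 1 x = x;
  actA : forall (a b : A) (x : M), act (a * b) x = act a (act b x);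
  actDl : forall (a b : A) (x : M), act (a + b) x = act a x + act b x;
  actDr : forall (a : A) (x y : M), act a (x + y) = act a x + act a y;
  actZl : forall (k : R[i]) (a : A) (x : M), act (k *: a) x = k *: act a x;
  actZr : forall (k : R[i]) (a : A) (x : M), act a (k *: x) = k *: act a x;
  inner : M -> M -> A;
  inner_ge0 : forall x : M, cstar_pos (inner x x);
  inner_eq0 : forall x : M, inner x x = 0 -> x = 0;
  innerPl : forall (k : R[i]) (x y z : M),
    inner (k *: x + y) z = k *: inner x z + inner y z;
  inner_act : forall (a : A) (x y : M), inner (act a x) y = a * inner x y;
  inner_star : forall x y : M, inner x y = star (inner y x);
  hilbert_norm : forall x : M, `|x| = sqrtC `|inner x x|
}.

#[short(type="hilbertModType")]
HB.structure Definition HilbertModule (R : realType) (A : cstarAlgType R) :=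
  {M of CompleteNormedModule R[i] M & NormedModule_isHilbertModule R A M}.

Arguments act {R A s} a x.
Arguments inner {R A s} x y.

Section bounded_module_maps.
Context {R : realType} {A : cstarAlgType R} {M : hilbertModType A}.

Definition bounded_module_map (N : normedModType R[i]) (actN : A -> N -> N)
    (T : M -> N) : Prop :=
  [/\ linear T,
      forall (a : A) (x : M), T (act a x) = actN a (T x)
    & exists C : R[i], forall x : M, `|T x| <= C * `|x|].

Definition dual_module : set (M -> A) :=
  [set f | bounded_module_map (fun a b : A => a * b) f].

End bounded_module_maps.
Arguments dual_module {R A} M.

Section endomorphisms.
Context {R : realType} {A : cstarAlgType R} (M : hilbertModType A).

Definition endo_pred : {pred M -> M} :=
  fun T => `[< bounded_module_map (@act R A M) T >].

Record endo := Endo { endo_fun :> M -> M; _ : endo_fun \in endo_pred }.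

HB.instance Definition _ := [isSub for endo_fun].
HB.instance Definition _ := [Choice of endo by <:].

Lemma endo_predP (T : M -> M) :
  reflect (bounded_module_map (@act R A M) T) (T \in endo_pred).
Proof. exact: asboolP. Qed.

Lemma endoP (T : endo) : bounded_module_map (@act R A M) T.
Proof. by apply/endo_predP; case: T. Qed.

Lemma bounded_module_map_bound (N : normedModType R[i]) actN (T : M -> N) :
  bounded_module_map actN T ->
  exists2 C : R[i], 0 <= C & forall x : M, `|T x| <= C * `|x|.
Proof.
case=> linT _ [C TC]; have [[x xN0]|M0] := pselect (exists x : M, x != 0).
  exists C => //; have := le_trans (normr_ge0 _) (TC x).
  by rewrite pmulr_lge0 // normr_gt0.
exists 0 => // x; have -> : x = 0 by apply: contrapT => /eqP xN0; apply: M0; exists x.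
have := TC 0; rewrite !normr0 !mulr0; exact.
Qed.

Fact endo_submod_closed : submod_closed endo_pred.
Proof.
split=> [|k S T /endo_predP Sb /endo_predP Tb]; apply/endo_predP.
  split=> [c x y|a x|].
  - by change ((0 : M) = c *: 0 + 0); rewrite scaler0 addr0.
  - change ((0 : M) = act a 0).
    by apply: (@addIr _ (act a 0)); rewrite -actDr !add0r.
  - by exists 0 => x; rewrite [X in `|X|](_ : _ = 0)// normr0 mul0r.
have [C C0 SC] := bounded_module_map_bound Sb.
have [D D0 TD] := bounded_module_map_bound Tb.
have [linS SA _] := Sb; have [linT TA _] := Tb.
have E x : (k *: S + T) x = k *: S x + T x by [].
split=> [c x y|a x|].
- by rewrite !E linS linT !scalerDr !scalerA [k * c]mulrC addrACA.
- by rewrite !E SA TA actDr actZr.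
exists (`|k| * C + D) => x; rewrite E mulrDl.
by rewrite (le_trans (ler_normD _ _))// lerD// normrZ -mulrA ler_wpM2l.
Qed.

HB.instance Definition _ :=
  GRing.isSubmodClosed.Build R[i] (M -> M) endo_pred endo_submod_closed.
HB.instance Definition _ := [SubChoice_isSubLmodule of endo by <:].

Fact endo_one_subproof : idfun \in endo_pred.
Proof. by apply/endo_predP; split=> //; exists 1 => x; rewrite mul1r. Qed.

Fact endo_mul_subproof (S T : endo) : S \o T \in endo_pred.
Proof.
have [C C0 SC] := bounded_module_map_bound (endoP S).
have [D D0 TD] := bounded_module_map_bound (endoP T).
have [linS SA _] := endoP S; have [linT TA _] := endoP T.
apply/endo_predP; split=> [k x y|a x|] /=.
- by rewrite linT linS.
- by rewrite TA SA.
by exists (C * D) => x; rewrite (le_trans (SC _))// -mulrA ler_wpM2l.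
Qed.

Definition endo_one : endo := Endo endo_one_subproof.
Definition endo_mul (S T : endo) : endo := Endo (endo_mul_subproof S T).

Lemma endo_ext (S T : endo) : (forall x, S x = T x) -> S = T.
Proof. by move=> ST; apply/val_inj/funext. Qed.

Lemma endoD (S T : endo) x : (S + T) x = S x + T x.
Proof. by []. Qed.

Lemma endoZ (k : R[i]) (T : endo) x : (k *: T) x = k *: T x.
Proof. by []. Qed.

Lemma endo_is_linear (T : endo) : linear T.
Proof. by case: (endoP T). Qed.

Lemma endo_addr (T : endo) x y : T (x + y) = T x + T y.
Proof. by have := endo_is_linear T 1 x y; rewrite !scale1r. Qed.

Fact endo_mulA : associative endo_mul.
Proof. by move=> S T U; apply: endo_ext. Qed.
Fact endo_mul1 : left_id endo_one endo_mul.
Proof. by move=> S; apply: endo_ext. Qed.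
Fact endo_mulr1 : right_id endo_one endo_mul.
Proof. by move=> S; apply: endo_ext. Qed.
Fact endo_mulDl : left_distributive endo_mul +%R.
Proof. by move=> S T U; apply: endo_ext. Qed.
Fact endo_mulDr : right_distributive endo_mul +%R.
Proof. by move=> S T U; apply: endo_ext => x /=; rewrite endo_addr. Qed.

HB.instance Definition _ := GRing.Zmodule_isPzRing.Build endo
  endo_mulA endo_mul1 endo_mulr1 endo_mulDl endo_mulDr.

End endomorphisms.
Arguments endo_pred {R A} M.

Section norm_facts.
Context {R : realType} {A : cstarAlgType R}.

Lemma norm_star (a : A) : `|star a| = `|a|.
Proof.
suff le_star (b : A) : `|b| <= `|star b|.
  by apply/eqP; rewrite eq_le le_star -{2}(starK a) le_star.
have [->|bN0] := eqVneq b 0; first by rewrite normr0.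
by rewrite -(@ler_pM2r _ `|b|) ?normr_gt0// -expr2 -cstar_norm cstar_normM.
Qed.

Lemma norm_act {M : hilbertModType A} (a : A) (x : M) :
  `|act a x| <= `|a| * `|x|.
Proof.
have innerE : inner (act a x) (act a x) = a * (inner x x * star a).
  by rewrite inner_act inner_star inner_act starM -inner_star.
have sq (y : M) : `|y| ^+ 2 = `|inner y y| by rewrite hilbert_norm sqrtCK.
rewrite -ler_sqr ?nnegrE ?mulr_ge0// exprMn !sq innerE.
rewrite (le_trans (cstar_normM _ _))// expr2 -mulrA ler_wpM2l//.
by rewrite (le_trans (cstar_normM _ _))// norm_star mulrC.
Qed.

End norm_facts.

Section endo_module.
Context {R : realType} {A : comCStarAlgType R} {M : hilbertModType A}.

Fact endo_act_subproof (a : A) (T : endo M) :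
  (fun x => act a (T x)) \in endo_pred M.
Proof.
have [C C0 TC] := bounded_module_map_bound (endoP T).
have [linT TA _] := endoP T.
apply/endo_predP; split=> [k x y|b x|] /=.
- by rewrite linT actDr actZr.
- by rewrite TA -!actA mulrC.
exists (`|a| * C) => x; rewrite (le_trans (norm_act _ _))// -mulrA.
by rewrite ler_wpM2l.
Qed.

Definition endo_act (a : A) (T : endo M) : endo M :=
  Endo (endo_act_subproof a T).

Definition endo_alinear (delta : endo M -> endo M) : Prop :=
  forall (a : A) (T : endo M), delta (endo_act a T) = endo_act a (delta T).

End endo_module.

Section derivations.
Context {R : realType} {A : cstarAlgType R} {M : hilbertModType A}.

Definition derivation (d : {linear endo M -> endo M}) : Prop :=
  forall S T : endo M, d (S * T) = d S * T + S * d T.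

Definition local_derivation (delta : {linear endo M -> endo M}) : Prop :=
  forall T : endo M,
    exists2 d : {linear endo M -> endo M}, derivation d & delta T = d T.

End derivations.

(* Main.v *)
(* If X Y = 0 = Y Z then X (delta Y) Z = 0, because this holds for the derivation
   that agrees with delta at Y. Decomposing along p, 1 - p and q, 1 - q, one gets
     delta(S T U) + S (delta T) U = delta(S T) U + S delta(T U)
   for idempotents S, U and all T, and then for all S, U in the A-algebra that
   the idempotents generate. If f0 x0 = 1, this algebra contains every rank-one
   operator y |-> f(y) x. The rank-one operators span an ideal with trivial left
   and right annihilators, so the identity forces delta to be a derivation. *)
Require Import Defs.
From HB Require Import structures.
From mathcomp Require Import all_boot all_order all_algebra.
From mathcomp Require Import complex.
From mathcomp Require Import all_classical all_reals all_analysis.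
Local Open Scope ring_scope.

Import Order.TTheory GRing.Theory Num.Theory.

(** * The triple identity over a ring with an additive map *)

Section triple_leibniz.
Context {B : pzRingType}.

Definition idempotent (p : B) : Prop := p * p = p.

Lemma idempotentC (p : B) : idempotent p -> p * (1 - p) = 0 /\ (1 - p) * p = 0.
Proof. by move=> pp; rewrite mulrBr mulrBl mul1r mulr1 pp subrr. Qed.

Lemma idempotentD (p n : B) :
  idempotent p -> p * n + n * p = n -> n * n = 0 -> idempotent (p + n).
Proof.
rewrite /idempotent => pp pn nn.
by rewrite mulrDl !mulrDr pp nn addr0 -addrA pn.
Qed.

Definition triple_leibniz (delta : B -> B) (S T U : B) : Prop :=
  delta (S * T * U) + S * delta T * U = delta (S * T) * U + S * delta (T * U).

Context (delta : {additive B -> B}).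

Lemma triple_leibnizBl (S S' T U : B) :
  triple_leibniz delta S T U -> triple_leibniz delta S' T U ->
  triple_leibniz delta (S - S') T U.
Proof.
move=> e e'; rewrite /triple_leibniz !mulrBl !raddfB /= !mulrBl.
by rewrite addrACA -opprD e e' opprD addrACA.
Qed.

Lemma triple_leibnizBr (S T U U' : B) :
  triple_leibniz delta S T U -> triple_leibniz delta S T U' ->
  triple_leibniz delta S T (U - U').
Proof.
move=> e e'; rewrite /triple_leibniz !mulrBr !raddfB /= !mulrBr.
by rewrite addrACA -opprD e e' opprD addrACA.
Qed.

(** In the sum of the identity at [S, S' * T, U] and [S] times the identity at [S', T, U], the terms
    [S * delta (S' * T) * U] and [S * delta (S' * T * U)] cancel. *)
Lemma triple_leibnizMl (S S' T U : B) :
  triple_leibniz delta S (S' * T) U -> triple_leibniz delta S' T U ->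
  triple_leibniz delta (S * S') T U.
Proof.
rewrite /triple_leibniz !mulrA => /(canRL (addrK _)) e /(congr1 ( *%R S)).
rewrite !mulrDr !mulrA e => e'.
by rewrite addrAC -[X in X - _]addrA e' addrCA addrAC subrr add0r.
Qed.

Lemma triple_leibnizMr (S T U U' : B) :
  triple_leibniz delta S (T * U) U' -> triple_leibniz delta S T U ->
  triple_leibniz delta S T (U * U').
Proof.
rewrite /triple_leibniz !mulrA => /(canRL (addrK _)) e /(congr1 ( *%R^~ U')).
rewrite /= !mulrDl e => e'.
by rewrite addrAC [X in X - _]addrAC e' [X in X - _]addrAC addrK.
Qed.

(** Elements of [J] can be cancelled jointly on either side, so the Leibniz rule is proved first
    with right factor in [J], then in general. *)
Lemma derivation_of_faithful_ideal (J : B -> Prop) :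
  (forall E T, J E -> J (E * T)) -> (forall T E, J E -> J (T * E)) ->
  (forall T, (forall E, J E -> E * T = 0) -> T = 0) ->
  (forall T, (forall E, J E -> T * E = 0) -> T = 0) ->
  (forall E T F, J E -> J F -> triple_leibniz delta E T F) ->
  delta 1 = 0 ->
  forall S T, delta (S * T) = delta S * T + S * delta T.
Proof.
move=> JMr JMl Jfl Jfr tl delta1.
have deltaMJ T F : J F -> delta (T * F) = delta T * F + T * delta F.
  move=> JF; apply: subr0_eq; apply: Jfl => E JE.
  (* Both triples contain [delta (E * T * F)] and [delta (E * T) * F]; comparing them leaves the
     Leibniz rule for [T * F] multiplied by [E]. *)
  have := tl (E * T) 1 F (JMr _ _ JE) JF; have := tl E T F JE JF.
  rewrite /triple_leibniz !mulr1 mul1r delta1 mulr0 mul0r addr0 => e1 e2.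
  move: e1; rewrite e2 -addrA => /addrI e1.
  by rewrite mulrBr -e1 mulrDr !mulrA addrC subrr.
move=> S T; apply: subr0_eq; apply: Jfr => F JF.
(* [delta (S * T * F)] is expanded twice, with right factor [F] and with right factor [T * F], both
   in [J]. *)
have := deltaMJ (S * T) F JF; rewrite -mulrA deltaMJ; last exact: JMl.
rewrite (deltaMJ T)// mulrDr !mulrA addrA => /addIr e.
by rewrite mulrBl mulrDl e subrr.
Qed.

(** The added term is the corner [(1 - p) * g * p], which squares to zero. *)
Lemma idempotent_add_corner_l (p g : B) :
  idempotent p -> g * p = g -> idempotent (p + (g - p * g)).
Proof.
move=> pp gp; have pn : p * (g - p * g) = 0 by rewrite mulrBr mulrA pp subrr.
have np : (g - p * g) * p = g - p * g by rewrite mulrBl -mulrA gp.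
apply: idempotentD => //; first by rewrite pn np add0r.
by rewrite -{1}np -mulrA pn mulr0.
Qed.

Lemma idempotent_add_corner_r (p g : B) :
  idempotent p -> p * g = g -> idempotent (p + (g - g * p)).
Proof.
move=> pp pg; have np : (g - g * p) * p = 0 by rewrite mulrBl -mulrA pp subrr.
have pn : p * (g - g * p) = g - g * p by rewrite mulrBr mulrA pg.
apply: idempotentD => //; first by rewrite pn np addr0.
by rewrite -{2}pn mulrA np mul0r.
Qed.

Hypothesis annih : forall x y z, x * y = 0 -> y * z = 0 -> x * delta y * z = 0.

(** Split [y = y * q + y * (1 - q)]: [1 - q] annihilates the first part on the right and [q] the
    second, so [annih] applies to each. *)
Lemma annihilator_idempotent (x y q : B) :
  idempotent q -> x * y = 0 -> x * delta (y * q) = x * delta y * q.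
Proof.
move=> /idempotentC[qqC qCq] xy.
have e1 : x * delta (y * q) * (1 - q) = 0.
  by apply: annih; rewrite ?mulrA ?xy ?mul0r// -mulrA qqC mulr0.
have e2 : x * delta (y * (1 - q)) * q = 0.
  by apply: annih; rewrite ?mulrA ?xy ?mul0r// -mulrA qCq mulr0.
move: e1; rewrite mulrBr mulr1 => /subr0_eq ->.
by move: e2; rewrite mulrBr mulr1 raddfB mulrBr mulrBl => /subr0_eq.
Qed.

Lemma triple_leibniz_idempotent (p t q : B) :
  idempotent p -> idempotent q -> triple_leibniz delta p t q.
Proof.
move=> /idempotentC[ppC pCp] qq; rewrite /triple_leibniz.
(* The claim is the difference of this equation and the one with [p] and [1 - p] exchanged. *)
have : (1 - p) * delta (p * t * q) = (1 - p) * delta (p * t) * q.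
  by apply: annihilator_idempotent; rewrite ?mulrA ?pCp ?mul0r.
rewrite !(mulrBl, mul1r) => /(canRL (subrK _)) ->.
have : p * delta ((1 - p) * t * q) = p * delta ((1 - p) * t) * q.
  by apply: annihilator_idempotent; rewrite ?mulrA ?ppC ?mul0r.
rewrite !(mulrBl, mul1r) !raddfB /= !(mulrBl, mulrBr) => /(canRL (subKr _)) ->.
by rewrite opprB !addrA subrK addrAC subrK.
Qed.

End triple_leibniz.

(** * Rank-one operators: an ideal with trivial annihilators *)

Section rank_one.
Context {R : realType} {A : cstarAlgType R} {M : hilbertModType A}.

Fact rank_one_subproof (x : M) (f : M -> A) (hf : dual_module M f) :
  (fun y => act (f y) x) \in endo_pred M.
Proof.
have [linf fA [C fC]] := hf; apply/endo_predP; split=> [k y z|a y|].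
- by rewrite linf actDl actZl.
- by rewrite fA actA.
exists (C * `|x|) => y; rewrite (le_trans (norm_act _ _))// mulrAC.
by rewrite ler_wpM2r.
Qed.

Definition rank_one (x : M) (f : M -> A) (hf : dual_module M f) : endo M :=
  Endo (rank_one_subproof x f hf).

Lemma inner_Pr (k : R[i]) (x y z : M) :
  inner x (k *: y + z) = Num.conj k *: inner x y + inner x z.
Proof.
by rewrite inner_star innerPl starP -inner_star -inner_star.
Qed.

Lemma inner_Dl (x y z : M) : inner (x + y) z = inner x z + inner y z.
Proof. by have := innerPl 1 x y z; rewrite !scale1r. Qed.

Lemma inner_Zl k (x z : M) : inner (k *: x) z = k *: inner x z.
Proof.
have i0 : inner 0 z = 0 :> A.
  by apply: (addrI (inner 0 z)); rewrite -inner_Dl !addr0.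
by have := innerPl k x 0 z; rewrite i0 !addr0.
Qed.

Lemma inner_polarization (x y : M) :
  4 *: inner x y =
    inner (x + y) (x + y) - inner (x - y) (x - y) +
    'i *: (inner (x + 'i *: y) (x + 'i *: y) -
           inner (x - 'i *: y) (x - 'i *: y)).
Proof.
have inner_sq (k : R[i]) : inner (x + k *: y) (x + k *: y) =
    inner x x + (Num.conj k *: inner x y + k *: inner y x) +
    (k * Num.conj k) *: inner y y.
  rewrite inner_Dl inner_Zl ![_ + k *: y]addrC !inner_Pr scalerDr scalerA.
  by rewrite [X in X + _]addrC [X in _ + X]addrC !addrA.
have diff (k : R[i]) :
    inner (x + k *: y) (x + k *: y) - inner (x - k *: y) (x - k *: y) =
    2 *: (Num.conj k *: inner x y + k *: inner y x).
  rewrite -scaleNr !inner_sq rmorphN mulrNN opprD addrACA subrr addr0.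
  rewrite opprD addrACA subrr add0r !scaleNr -opprD opprK.
  by rewrite scaler_nat mulr2n.
(* [k = 1] gives the sum of [inner x y] and [inner y x], [k = 'i] their difference, each doubled. *)
have := diff 1; rewrite !scale1r => ->; rewrite diff.
rewrite conjCi rmorph1 !scalerDr !scalerA.
have iNi : 'i * 2 * - 'i = 2 :> R[i].
  by rewrite mulrN mulrAC -expr2 sqrCi mulN1r opprK.
have ii : 'i * 2 * 'i = - 2 :> R[i] by rewrite mulrAC -expr2 sqrCi mulN1r.
rewrite iNi ii mulr1 scaleNr addrA addrAC addrK -scalerDl.
by rewrite -natrD.
Qed.

(* Weaker than Cauchy-Schwarz, but polarization gives it without positivity. *)
Lemma norm_inner_le (x y : M) : `|inner x y| <= (`|x| + `|y|) ^+ 2.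
Proof.
have sq (k : R[i]) : `|k| = 1 ->
    `|inner (x + k *: y) (x + k *: y)| <= (`|x| + `|y|) ^+ 2.
  move=> k1; rewrite -[`|inner _ _|]sqrtCK -hilbert_norm.
  rewrite lerXn2r ?nnegrE ?addr_ge0// (le_trans (ler_normD _ _))//.
  by rewrite normrZ k1 mul1r.
have sqB (k : R[i]) : `|k| = 1 ->
    `|inner (x + k *: y) (x + k *: y) - inner (x - k *: y) (x - k *: y)| <=
    (`|x| + `|y|) ^+ 2 *+ 2.
  move=> k1; rewrite (le_trans (ler_normB _ _))// mulr2n lerD ?sq//.
  by rewrite -scaleNr sq// normrN.
rewrite -(@ler_pM2l _ 4)// -[X in X * `|_|]normr_nat -normrZ inner_polarization.
rewrite (le_trans (ler_normD _ _))// normrZ normCi mul1r mulr_natl.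
rewrite (mulrnDr _ 2 2) lerD//; last by rewrite sqB ?normCi.
by have := sqB 1; rewrite normr1 !scale1r; exact.
Qed.

Lemma dual_module_inner (w : M) : dual_module M (inner^~ w).
Proof.
split=> [k x y|a x|]; [exact: innerPl|exact: inner_act|].
(* The constant is the bound of [norm_inner_le] at the unit vector in the direction of [x]. *)
exists ((1 + `|w|) ^+ 2) => x; have [->|x0] := eqVneq x 0.
  by rewrite -(scale0r (0 : M)) inner_Zl !scale0r !normr0 mulr0.
rewrite -ler_pdivrMr ?normr_gt0// mulrC.
have nx : `| `|x|^-1 *: x | = 1.
  by rewrite normrZ normfV normr_id mulVf// normr_eq0.
have := norm_inner_le (`|x|^-1 *: x) w.
by rewrite nx inner_Zl normrZ normfV normr_id.
Qed.

Lemma dual_module_comp (f : M -> A) (T : endo M) :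
  dual_module M f -> dual_module M (f \o T).
Proof.
move=> hf; have [linf fA _] := hf; have [linT TA [D TD]] := endoP T.
have [C C0 fC] := bounded_module_map_bound hf; split=> [k y z|a y|] /=.
- by rewrite linT linf.
- by rewrite TA fA.
by exists (C * D) => y; rewrite (le_trans (fC _))// -mulrA ler_wpM2l.
Qed.

Definition is_rank_one (E : endo M) : Prop :=
  exists (x : M) (f : M -> A) (hf : dual_module M f), E = rank_one x f hf.

Lemma is_rank_oneMr (E T : endo M) : is_rank_one E -> is_rank_one (E * T).
Proof.
move=> [x [f [hf ->]]]; exists x, (f \o T), (dual_module_comp f T hf).
exact: endo_ext.
Qed.

Lemma is_rank_oneMl (T E : endo M) : is_rank_one E -> is_rank_one (T * E).
Proof.
move=> [x [f [hf ->]]]; exists (T x), f, hf; apply: endo_ext => y /=.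
by have [_ TA _] := endoP T; rewrite TA.
Qed.

Context (x0 : M) (f0 : M -> A) (hf0 : dual_module M f0).
Hypothesis f0x0 : f0 x0 = 1.

(** For [E] sending [y] to [act (inner y (T x)) x0], applying [f0] to [E (T x)] recovers
    [inner (T x) (T x)]. *)
Lemma rank_one_faithful_l (T : endo M) :
  (forall E, is_rank_one E -> E * T = 0) -> T = 0.
Proof.
move=> annT; apply: endo_ext => x; apply: inner_eq0.
have [linf f0A _] := hf0.
have f00 : f0 0 = 0.
  by have := linf (-1) 0 0; rewrite scaler0 addr0 scaleN1r addNr.
have ET0 := annT (rank_one x0 _ (dual_module_inner (T x))) _.
have /(congr1 (fun S : endo M => f0 (S x))) /= := ET0 ltac:(by do 3!eexists).
by rewrite f0A f0x0 mulr1 => ->.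
Qed.

Lemma rank_one_faithful_r (T : endo M) :
  (forall E, is_rank_one E -> T * E = 0) -> T = 0.
Proof.
move=> annT; apply: endo_ext => x.
have TE0 := annT (rank_one x _ hf0) _.
have /(congr1 (fun S : endo M => S x0)) /= := TE0 ltac:(by do 3!eexists).
by rewrite f0x0 act1.
Qed.

End rank_one.

(** * Generating rank-one operators from idempotents *)

Section commutative.
Context {R : realType} {A : comCStarAlgType R} {M : hilbertModType A}.

Inductive idempotent_generated : endo M -> Prop :=
| gen_idempotent p : idempotent p -> idempotent_generated p
| genB S T : idempotent_generated S -> idempotent_generated T ->
    idempotent_generated (S - T)
| genM S T : idempotent_generated S -> idempotent_generated T ->
    idempotent_generated (S * T)
| gen_act a T : idempotent_generated T -> idempotent_generated (endo_act a T).

Lemma endo_actMl (a : A) (S T : endo M) :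
  endo_act a S * T = endo_act a (S * T).
Proof. exact: endo_ext. Qed.

Lemma endo_actMr (a : A) (S T : endo M) :
  S * endo_act a T = endo_act a (S * T).
Proof. by apply: endo_ext => x /=; have [_ SA _] := endoP S; rewrite SA. Qed.

Lemma endo_actD (a : A) (S T : endo M) :
  endo_act a (S + T) = endo_act a S + endo_act a T.
Proof. by apply: endo_ext => x /=; rewrite actDr. Qed.

Lemma triple_leibniz_generated (delta : {linear endo M -> endo M})
    (S T U : endo M) :
  (forall x y z, x * y = 0 -> y * z = 0 -> x * delta y * z = 0) ->
  endo_alinear delta -> idempotent_generated S -> idempotent_generated U ->
  triple_leibniz delta S T U.
Proof.
move=> annih hA genS genU.
(* [T] stays general because the product cases use the identity at [S' * T] and [T * U]. *)
elim: genS T => {S} [p pp|S S' _ IH _ IH'|S S' _ IH _ IH'|a S _ IH] T.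
- elim: genU T => {U} [q qq|U U' _ IH _ IH'|U U' _ IH _ IH'|a U _ IH] T.
  + exact: triple_leibniz_idempotent.
  + exact: triple_leibnizBr.
  + exact: triple_leibnizMr.
  + by rewrite /triple_leibniz !endo_actMr !hA !endo_actMr -!endo_actD IH.
- exact: triple_leibnizBl.
- exact: triple_leibnizMl.
- by rewrite /triple_leibniz !endo_actMl !hA !endo_actMl -!endo_actD IH.
Qed.

(** The operator factors through [x0] as [g * h]. Since [f0 x0 = 1], [p] is idempotent, and [g] and
    [h] each differ from a square-zero corner of [p] by an [A]-multiple of [p]. *)
Lemma rank_one_generated (x0 : M) (f0 : M -> A) (hf0 : dual_module M f0)
    (E : endo M) :
  f0 x0 = 1 -> is_rank_one E -> idempotent_generated E.
Proof.
move=> f0x0 [x [f [hf ->]]]; have [_ f0A _] := hf0; have [_ fA _] := hf.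
pose p := rank_one x0 f0 hf0; pose g := rank_one x f0 hf0.
pose h := rank_one x0 f hf.
have pp : idempotent p by apply: endo_ext => y /=; rewrite f0A f0x0 mulr1.
have gp : g * p = g by apply: endo_ext => y /=; rewrite f0A f0x0 mulr1.
have ph : p * h = h by apply: endo_ext => y /=; rewrite f0A f0x0 mulr1.
have -> : rank_one x f hf = g * h.
  by apply: endo_ext => y /=; rewrite f0A f0x0 mulr1.
have pg : p * g = endo_act (f0 x) p.
  by apply: endo_ext => y /=; rewrite f0A -actA mulrC.
have hp : h * p = endo_act (f x0) p.
  by apply: endo_ext => y /=; rewrite fA -actA mulrC.
have gen_corner (k : endo M) a :
    idempotent (p + (k - endo_act a p)) -> idempotent_generated k.
  move=> idk; have -> : k = p + (k - endo_act a p) - (p - endo_act a p).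
    by rewrite opprB addrA -[X in X - _]addrA subrK addrAC subrr add0r.
  apply: genB; first exact: gen_idempotent.
  by apply: genB; [|apply: gen_act]; exact: gen_idempotent.
apply: genM.
- by apply: (gen_corner _ (f0 x)); rewrite -pg; exact: idempotent_add_corner_l.
- by apply: (gen_corner _ (f x0)); rewrite -hp; exact: idempotent_add_corner_r.
Qed.

End commutative.

(** * From local derivations to the annihilator condition *)

Section local_derivations.
Context {R : realType} {A : cstarAlgType R} {M : hilbertModType A}.

Lemma derivation1 (d : {linear endo M -> endo M}) : derivation d -> d 1 = 0.
Proof.
by move=> /(_ 1 1); rewrite !mulr1 mul1r -{1}[d 1]addr0 => /addrI ->.
Qed.

Lemma local_derivation_annihilator (delta : {linear endo M -> endo M})
    (X Y Z : endo M) :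
  local_derivation delta -> X * Y = 0 -> Y * Z = 0 -> X * delta Y * Z = 0.
Proof.
move=> hloc XY YZ; have [d der_d ->] := hloc Y.
(* Multiplying [0 = d X * Y + X * d Y] by [Z] on the right kills the first term. *)
have := der_d X Y; rewrite XY raddf0 => /(congr1 ( *%R^~ Z)) /=.
by rewrite mul0r mulrDl -mulrA YZ mulr0 add0r.
Qed.

End local_derivations.

Theorem corollary4p4 (R : realType) (A : comCStarAlgType R)
    (M : hilbertModType A)
    (hM : exists (x0 : M) (f0 : M -> A), dual_module M f0 /\ f0 x0 = 1)
    (delta : {linear endo M -> endo M})
    (hA : endo_alinear delta) (hloc : local_derivation delta) :
  derivation delta.
Proof.
have [x0 [f0 [hf0 f0x0]]] := hM.
apply: (derivation_of_faithful_ideal delta is_rank_one).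
- exact: is_rank_oneMr.
- exact: is_rank_oneMl.
- exact: rank_one_faithful_l hf0 f0x0.
- exact: rank_one_faithful_r hf0 f0x0.
- move=> E T F rE rF; apply: triple_leibniz_generated => //.
  + by move=> X Y Z; exact: local_derivation_annihilator.
  + exact: rank_one_generated hf0 _ f0x0 rE.
  + exact: rank_one_generated hf0 _ f0x0 rF.
- by have [d /derivation1 d1 e] := hloc 1; exact: etrans e d1.
Qed.
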